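(* Let $H$ be a hypergraph with $|e|>1$ for all hyperedges $e\in E(H)$. For each unit $W_E$ in $H$ with $|W_E|>1$, the adjacency matrix $A_{(2,H)}$ has an eigenvalue $-(s_u,s_v)$ of multiplicity $|W_E|-1$, where $u,v\in W_E$ with $v\neq u$.
   Context: A hypergraph $H$ is a pair $(V(H),E(H))$ with $V(H)$ a non-empty set (vertices) and $E(H)$ a set of non-empty subsets of $V(H)$ (hyperedges). The edge-vertex incidence matrix $B_H=[b_{ev}]_{e\in E(H),v\in V(H)}$ has $b_{ev}=1$ if $v\in e$ and $b_{ev}=0$ otherwise. For $v\in V(H)$, $s_v:E(H)\to\mathbb{C}$ denotes the column of $B_H$ indexed by $v$. For $x,y:E(H)\to\mathbb{C}$, $(x,y)=\sum_{e\in E(H)}\frac{1}{|e|-1}x(e)y(e)$. The star of a vertex $v$ is $E_v(H)=\{e\in E(H): v\in e\}$. A unit in $H$ is an equivalence class of the equivalence relation $\{(u,v)\in V(H)\times V(H): E_u(H)=E_v(H)\}$; $W_E$ denotes the unit all of whose vertices have star $E\subseteq E(H)$. $A_{(2,H)}=[a_{uv}]_{u,v\in V(H)}$ is the matrix with $a_{uv}=\sum_{e\in E_u(H)\cap E_v(H)}\frac{1}{|e|-1}$ for distinct $u,v$ and zero diagonal entries.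
   Formalization: ''Of multiplicity |W_E|-1'' is proved as multiplicity at least |W_E|-1 (geometric and algebraic); exact equality is false: with V={1,2,3,4} and hyperedges {1,2},{3,4}, each unit has size 2 and gives -1, which has multiplicity 2. *)

(* Defs.v *)
From mathcomp Require Import all_boot all_order all_algebra.

Set Implicit Arguments.
Unset Strict Implicit.
Unset Printing Implicit Defensive.

Import Order.TTheory GRing.Theory Num.Theory.
Local Open Scope ring_scope.

Record hypergraph (V : finType) := Hypergraph {
  edges : {set {set V}};
  vertices_nonempty : (0 < #|V|)%N;
  edges_nonempty : forall e, e \in edges -> e != set0
}.

Definition star (V : finType) (H : hypergraph V) (v : V) : {set {set V}} :=
  [set e in edges H | v \in e].

Definition units (V : finType) (H : hypergraph V) : {set {set V}} :=
  equivalence_partition [rel u v | star H u == star H v] [set: V].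

(* Rows and columns of the matrices below are numbered by [enum_val], for the
   hyperedges (['I_#|edges H|]) and for the vertices (['I_#|V|]). *)

Definition incidence_mx (C : numClosedFieldType) (V : finType)
    (H : hypergraph V) : 'M[C]_(#|edges H|, #|V|) :=
  \matrix_(i < #|edges H|, j < #|V|)
    ((enum_val j : V) \in (enum_val i : {set V}))%:R.

(* The functions s_v : E(H) -> C, as column vectors. *)
Definition svec (C : numClosedFieldType) (V : finType) (H : hypergraph V)
    (v : V) : 'cV[C]_#|edges H| :=
  col (enum_rank v) (incidence_mx C H).

(* Bilinear: there is no complex conjugation on the second argument. *)
Definition edge_form (C : numClosedFieldType) (V : finType) (H : hypergraph V)
    (x y : 'cV[C]_#|edges H|) : C :=
  \sum_(i < #|edges H|) (#|(enum_val i : {set V})|%:R - 1)^-1 * x i 0 * y i 0.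

Definition adjacency_mx (C : numClosedFieldType) (V : finType)
    (H : hypergraph V) : 'M[C]_#|V| :=
  \matrix_(i < #|V|, j < #|V|)
    if i == j then 0
    else \sum_(e in star H (enum_val i) :&: star H (enum_val j))
           (#|e|%:R - 1)^-1.

(* [a] is an eigenvalue of [A] to which at least [k] dimensions of eigenvectors,
   and at least [k] roots of the characteristic polynomial, belong.  The lower
   bound is what "an eigenvalue of multiplicity k attached to a unit" means:
   distinct units may yield the same eigenvalue, e.g. the hyperedges {1,2} and
   {3,4} each give a unit of size 2 with value -1, whose total multiplicity
   is 2.  [eigenspace] consists of row eigenvectors; for the symmetric
   [adjacency_mx] these are the transposes of the column eigenvectors. *)
Definition eigenvalue_of_mult (C : numClosedFieldType) (n : nat)
    (A : 'M[C]_n) (a : C) (k : nat) : Prop :=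
  [/\ eigenvalue A a,
      (k <= \rank (eigenspace A a))%N &
      (k <= mup a (char_poly A))%N].

(* Main.v *)
Require Import Defs.
From mathcomp Require Import all_boot all_order all_algebra.

Import Order.TTheory GRing.Theory Num.Theory.
Local Open Scope ring_scope.

(** Two vertices [u] and [w] of one unit lie in the same hyperedges, so their
    rows in the adjacency matrix [A] agree outside the columns [u] and [w]; on
    these two columns they differ by the common entry [a_uw] and by the zero
    diagonal.  Hence [(delta_w - delta_u) A = - a_uw (delta_w - delta_u)], and
    [a_uw] is the edge form of [s_u] with [s_v] for any [v] of the unit, since
    both are the sum of [1 / (|e| - 1)] over the common star
    ([adjacency_twin_eigenvector], [edge_form_svec]).  For fixed [u], the
    vectors [delta_w - delta_u] with [w] in the unit span a space of
    codimension at most one in the span of the [delta_w], which gives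
    [|W| - 1] independent eigenvectors ([rank_delta_differences]).

    Roots of the characteristic polynomial then come from the general fact that
    the geometric multiplicity is at most the algebraic one
    ([rank_eigenspace_le_mup]). *)

(** Complete a basis of the eigenspace, of dimension [r], to the rows of an
    invertible matrix [P], basis first.  In [P ('X - A)] each of the first [r] rows is ['X - a] times a constant row,
    so [('X - a)^r] factors out of [\det P * char_poly A]. *)
Lemma rank_eigenspace_le_mup (F : fieldType) (n : nat) (A : 'M[F]_n) (a : F) :
  (\rank (eigenspace A a) <= mup a (char_poly A))%N.
Proof.
set E := eigenspace A a; set r := \rank E; set P := row_ebase E.
have Punit : P \in unitmx by exact: row_ebase_unit.
have eigP : (pid_mx r : 'M_n) *m P *m A = a *: ((pid_mx r : 'M_n) *m P).
  apply/eigenspaceP; rewrite -/E -[X in (_ <= X)%MS](mulmx_ebase E) -mulmxA.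
  have Lfull : row_full (col_ebase E) by rewrite row_full_unit col_ebase_unit.
  by rewrite (eqmxMfull (pid_mx r *m P) Lfull).
have rowP (i j : 'I_n) : (i < r)%N -> (P *m A) i j = a * P i j.
  move=> lt_ir; have /matrixP /(_ i j) := eigP.
  have pidE (B : 'M_n) : ((pid_mx r : 'M_n) *m B) i j = B i j.
    rewrite mxE (bigD1 i) //= mxE eqxx lt_ir mul1r big1 ?addr0 // => k ki.
    by rewrite mxE [_ == _]eq_sym (negbTE ki : (k == i :> nat) = false) mul0r.
  by rewrite -mulmxA pidE [RHS]mxE pidE.
pose PX := map_mx polyC P *m char_poly_mx A.
pose d : 'rV[{poly F}]_n := \row_i (if (i < r)%N then 'X - a%:P else 1).
pose Q : 'M[{poly F}]_n :=
  \matrix_(i, j) (if (i < r)%N then (P i j)%:P else PX i j).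
have PXE : PX = diag_mx d *m Q.
  apply/matrixP=> i j; rewrite mul_diag_mx [RHS]mxE [d _ _]mxE [Q _ _]mxE.
  case: ifP => [lt_ir|_]; last by rewrite mul1r.
  rewrite /PX /char_poly_mx mulmxBr -map_mxM scalar_mxC mul_scalar_mx.
  rewrite [LHS]mxE [X in X + _]mxE [X in _ * X]mxE [X in _ + X]mxE.
  by rewrite [X in _ - X]mxE rowP // [X in _ - X]polyCM mulrBl.
have detd : \det (diag_mx d) = ('X - a%:P) ^+ r.
  rewrite det_diag (eq_bigr _ (fun i _ => mxE _ _ _ _)) -big_mkcond /=.
  by rewrite (big_ord_narrow (rank_leq_row E)) prodr_const card_ord.
rewrite mup_geq ?monic_neq0 ?char_poly_monic // -detd.
have detP : (\det P)%:P * char_poly A = \det (diag_mx d) * \det Q.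
  by rewrite -det_mulmx -PXE det_mulmx det_map_mx.
have detP0 : \det P != 0 by rewrite -unitfE -unitmxE.
by rewrite -(dvdpZr _ _ detP0) -mul_polyC detP dvdp_mulr.
Qed.

(** Adding back [delta_u] to every row, a matrix of rank at most one, gives
    distinct basis vectors, which are independent. *)
Lemma rank_delta_differences (F : fieldType) (k n : nat) (f : 'I_k -> 'I_n)
    (u : 'I_n) :
  injective f ->
  (k - 1 <=
     \rank (\matrix_(i < k) (delta_mx 0 (f i) - delta_mx 0 u : 'rV[F]_n)%R))%N.
Proof.
move=> f_inj; set M := \matrix_i _.
pose D : 'M[F]_(k, n) := \matrix_(i < k) (delta_mx 0 (f i) : 'rV_n).
pose J : 'M[F]_(k, n) := const_mx 1 *m (delta_mx 0 u : 'rV_n).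
have DE : D = M + J.
  apply/row_matrixP=> i; rewrite raddfD /= !rowK row_mul.
  by have -> : row i (const_mx 1) = 1%:M :> 'M[F]_1;
    [apply/matrixP=> s t; rewrite !mxE !ord1 | rewrite mul1mx subrK].
have DDt : D *m D^T = 1%:M.
  apply/matrixP=> i j; rewrite !mxE (bigD1 (f i)) //= !mxE !eqxx mul1r big1.
    by rewrite addr0 (inj_eq f_inj).
  by move=> s /negbTE sfi; rewrite !mxE sfi andbF mul0r.
have rankD : (k <= \rank D)%N.
  by rewrite -[X in (X <= _)%N](mxrank1 F) -DDt mxrankM_maxl.
have rankJ : (\rank J <= 1)%N.
  by apply: leq_trans (mxrankM_maxr _ _) (rank_leq_row _).
rewrite leq_subLR addnC (leq_trans rankD) // DE (leq_trans (mxrank_add _ _)) //.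
by rewrite leq_add2l.
Qed.

Lemma units_same_star {V : finType} {H : hypergraph V} {W : {set V}} {u v : V} :
  W \in units H -> u \in W -> v \in W -> star H u = star H v.
Proof.
case/imsetP=> x _ ->; rewrite !inE /= => /eqP xu /eqP xv.
by rewrite -xu.
Qed.

Lemma edge_form_svec (C : numClosedFieldType) (V : finType) (H : hypergraph V)
    (u v : V) :
  edge_form (svec C H u) (svec C H v) =
    \sum_(e in star H u :&: star H v) (#|e|%:R - 1)^-1.
Proof.
rewrite [RHS]big_mkcond /= (bigID (mem (edges H))) /= [X in _ + X]big1.
  rewrite addr0 big_enum_val /edge_form; apply: eq_bigr => i _.
  rewrite !mxE !enum_rankK !inE enum_valP /=.
  by case: (u \in _); case: (v \in _); rewrite ?mulr0 ?mul0r ?mulr1.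
by move=> e /negbTE eH; rewrite !inE eH.
Qed.

(** Rows [w] and [u] of the adjacency matrix differ only in columns [w] and [u],
    where the zero diagonal meets the common entry [a_uw].  For [w = u] the
    vector is zero and the identity is trivial. *)
Lemma adjacency_twin_eigenvector (C : numClosedFieldType) (V : finType)
    (H : hypergraph V) (u v w : V) :
  star H u = star H v -> star H w = star H u ->
  let x : 'rV[C]_#|V| := delta_mx 0 (enum_rank w) - delta_mx 0 (enum_rank u) in
  x *m adjacency_mx C H = - edge_form (svec C H u) (svec C H v) *: x.
Proof.
move=> uv wu x; rewrite edge_form_svec -uv setIid /x mulmxBl -!rowE.
apply/rowP=> j; rewrite !mxE !enum_rankK wu eqxx /= ![j == _]eq_sym.
have [wj|wj] := eqVneq (enum_rank w) j; have [uj|uj] := eqVneq (enum_rank u) j.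
- by rewrite !subrr mulr0.
- by rewrite -wj enum_rankK wu setIid subr0 mulr1 sub0r.
- by rewrite -uj enum_rankK setIid subr0 sub0r mulrNN mulr1.
- by rewrite !subrr mulr0.
Qed.

Theorem theorem3p3 (C : numClosedFieldType) (V : finType) (H : hypergraph V)
  (edges_gt1 : forall e : {set V}, e \in edges H -> (1 < #|e|)%N)
  (W : {set V}) (unitW : W \in units H) (W_gt1 : (1 < #|W|)%N)
  (u v : V) (uW : u \in W) (vW : v \in W) (neq_vu : v != u) :
  eigenvalue_of_mult (adjacency_mx C H)
    (- edge_form (svec C H u) (svec C H v)) (#|W| - 1)%N.
Proof.
set A := adjacency_mx C H; set a := - _.
pose f (i : 'I_#|W|) := enum_rank (enum_val i).
have f_inj : injective f by move=> i j /enum_rank_inj /enum_val_inj.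
have rank_ge : (#|W| - 1 <= \rank (eigenspace A a))%N.
  apply: leq_trans (rank_delta_differences C _ _ _ (enum_rank u) f_inj) (mxrankS _).
  apply/row_subP=> i; rewrite rowK; apply/eigenspaceP.
  apply: adjacency_twin_eigenvector; first exact: units_same_star unitW uW vW.
  exact: units_same_star unitW (enum_valP i) uW.
split=> //; last exact: leq_trans rank_ge (rank_eigenspace_le_mup _ _ _ _).
by rewrite /eigenvalue -mxrank_eq0 -lt0n (leq_trans _ rank_ge) // subn_gt0.
Qed.
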